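(* Let $G$ be a finitely generated group which is hyperbolic relative to a finite family $\{H_1,\dots,H_k\}$ of finitely generated subgroups, each of which has polynomial growth. Then $G$ has property RD (with respect to its word length).
   Context: A length function on a group $G$ is a map $\ell:G\to\mathbb{R}_+$ with $\ell(e)=0$, $\ell(\gamma)=\ell(\gamma^{-1})$ and $\ell(\gamma\mu)\le \ell(\gamma)+\ell(\mu)$ for all $\gamma,\mu\in G$. For a finitely generated group the word length with respect to a finite generating set is a length function. For $f\in\mathbb{C}G$ (finitely supported functions $G\to\mathbb{C}$) let $\|f\|_2$ be the $\ell^2$-norm and $\|f\|_*=\sup\{\|f*g\|_2 : \|g\|_2=1\}$ the operator norm of $f$ acting by left convolution on $\ell^2(G)$. The group $G$ has property RD with respect to $\ell$ if there is a polynomial $P$ such that $\|f\|_*\le P(r)\|f\|_2$ for every $r\ge 0$ and every $f\in\mathbb{C}G$ supported in $\{\gamma:\ell(\gamma)\le r\}$ (equivalently, there are $C,s>0$ with $\|f\|_*\le C\,(\sum_\gamma |f(\gamma)|^2(1+\ell(\gamma))^{2s})^{1/2}$ for all $f\in\mathbb{C}G$). A finitely generated group has polynomial growth if the cardinality of the ball of radius $r$ for its word length is bounded by a polynomial in $r$. Relative hyperbolicity (Gromov). Let $X$ be a proper geodesic $\delta$-hyperbolic metric space with boundary $\partial X$ (equivalence classes of geodesic rays). For a geodesic ray $c$, the Busemann function is $b_c(x)=\limsup_{t\to\infty}(d(x,c(t))-t)$; its sublevel sets $b_c^{-1}(-\infty,r]$ are the horoballs centered at $c(\infty)$. Suppose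 $G$ acts properly discontinuously by isometries on $X$ and the quotient $X/G$ is quasi-isometric to a union of $k$ copies of $[0,\infty)$ joined at $0$. Lift these rays to obtain points $p_1,\dots,p_k\in\partial X$, choose geodesic rays $c_i$ with $c_i(\infty)=p_i$, let $H_i$ be the isotropy subgroup of $p_i$ in $G$, and assume $H_i$ preserves $b_{c_i}$. The action is geometrically finite with parabolic subgroups $\{H_1,\dots,H_k\}$ if there is a $G$-invariant system $\mathcal{B}$ of pairwise disjoint horoballs centered at the points $p_1,\dots,p_k$ (and their $G$-translates) such that $G$ acts cocompactly on $X\setminus\bigcup_{B\in\mathcal{B}}B$. The group $G$ is hyperbolic relative to the family $\{H_1,\dots,H_k\}$ of finitely generated subgroups if it admits a geometrically finite action on a proper geodesic $\delta$-hyperbolic metric space with parabolic subgroups $\{H_1,\dots,H_k\}$. (This is the standard notion of relative hyperbolicity, equivalent by Bowditch's work to Farb's definition together with the Bounded Coset Penetration Property.) *)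

(* Defs.v *)
From HB Require Import structures.
From mathcomp Require Import all_boot all_order all_algebra.
From mathcomp Require Import all_classical all_reals all_analysis.
From mathcomp Require Import complex.

Set Implicit Arguments.
Unset Strict Implicit.
Unset Printing Implicit Defensive.

Import Order.TTheory GRing.Theory Num.Theory.
Import numFieldNormedType.Exports.

Local Open Scope classical_set_scope.
Local Open Scope ring_scope.

Section Words.
Variables (R : realType) (G : groupType).
Implicit Types (S H : set G) (g : G) (w : seq G).

Definition word_for S g w : Prop :=
  (forall x, x \in w -> S x \/ S (x^-1)%g) /\ (\prod_(x <- w) x)%g = g.

Definition generated S : set G := [set g | exists w, word_for S g w].

(* The infimum is a minimum when g lies in the subgroup generated by S; it
   takes the junk value 0 otherwise. *)
Definition word_length S g : R :=
  inf [set (size w)%:R | w in [set w | word_for S g w]].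

Definition fin_gen_subgroup H : Prop :=
  exists S, finite_set S /\ generated S = H.

Definition polynomial_growth H : Prop :=
  exists S, [/\ finite_set S, generated S = H &
    exists P : {poly R}, forall r : R, 0 <= r ->
      exists2 n : nat,
        ([set h | H h /\ word_length S h <= r] #<= `I_n)%card & n%:R <= P.[r]].

End Words.

Section RapidDecay.
Variables (R : realType) (G : groupType).
Implicit Types (f g : G -> R[i]) (l : G -> R).

Definition fin_supp f : Prop := finite_set [set x | f x != 0].

Definition l2norm f : \bar R :=
  sqrte (\esum_(x in [set: G]) ((ComplexField.Normc.normc (f x)) ^+ 2)%:E).

(* The sum has finitely many nonzero terms as soon as f is finitely
   supported; g is arbitrary. *)
Definition convolution f g : G -> R[i] :=
  fun x => \sum_(y \in [set: G]) (f y * g (y^-1 * x)%g).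

Definition op_norm f : \bar R :=
  ereal_sup [set l2norm (convolution f g) | g in [set g | l2norm g = 1%E]].

Definition property_RD l : Prop :=
  exists P : {poly R}, forall (r : R) f, 0 <= r -> fin_supp f ->
    (forall x, f x != 0 -> l x <= r) ->
    (op_norm f <= (P.[r])%:E * l2norm f)%E.

End RapidDecay.

Section QuasiIsometry.
Variable R : realType.

Definition quasi_isometric_embedding (T U : Type) (dT : T -> T -> R)
    (dU : U -> U -> R) (A : set T) (f : T -> U) : Prop :=
  exists L C : R, [/\ 1 <= L, 0 <= C &
    forall x y, A x -> A y ->
      L^-1 * dT x y - C <= dU (f x) (f y) /\
      dU (f x) (f y) <= L * dT x y + C].

Definition quasi_isometry (T U : Type) (dT : T -> T -> R) (dU : U -> U -> R)
    (A : set T) (B : set U) (f : T -> U) : Prop :=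
  [/\ (forall x, A x -> B (f x)),
      quasi_isometric_embedding dT dU A f &
      exists C : R, forall y, B y -> exists2 x, A x & dU (f x) y <= C].

(* The union of k copies of [0, +oo[ joined at 0 is realized as the union of
   the nonnegative coordinate half-axes of R^k, on which the l^1 distance is
   the path distance; for k = 0 it is a point. *)
Definition half_axis (k : nat) (i : 'I_k) (t : R) : 'rV[R]_k :=
  t *: delta_mx 0 i.

Definition joined_rays (k : nat) : set 'rV[R]_k :=
  [set 0] `|` \bigcup_(i in [set: 'I_k]) (half_axis i @` [set t | 0 <= t]).

Definition joined_rays_dist (k : nat) (v w : 'rV[R]_k) : R :=
  \sum_(i < k) `|v 0 i - w 0 i|.

End QuasiIsometry.

Section HyperbolicSpaces.
Variables (R : realType) (X : metricType R).
Implicit Types (x y z : X) (c : R -> X) (A B : set X).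

Definition proper_space : Prop :=
  forall x (r : R), compact [set y : X | mdist x y <= r].

Definition geodesic_segment x y A : Prop :=
  exists c, [/\ c 0 = x, c (mdist x y) = y,
    (forall s t : R, 0 <= s <= mdist x y -> 0 <= t <= mdist x y ->
       mdist (c s) (c t) = `|s - t|) &
    A = c @` [set t | 0 <= t <= mdist x y]].

Definition geodesic_space : Prop := forall x y, exists A, geodesic_segment x y A.

Definition slim_triangles (delta : R) : Prop :=
  forall x y z A B C, geodesic_segment x y A -> geodesic_segment y z B ->
    geodesic_segment z x C ->
    forall a, A a -> exists2 b, (B `|` C) b & mdist a b <= delta.

(* Only the values at t >= 0 of a map R -> X representing a ray matter. *)
Definition geodesic_ray c : Prop :=
  forall s t : R, 0 <= s -> 0 <= t -> mdist (c s) (c t) = `|s - t|.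

Definition asymptotic c c' : Prop :=
  exists K : R, forall t : R, 0 <= t -> mdist (c t) (c' t) <= K.

(* A point of the boundary is an equivalence class of geodesic rays;
   [endpoint c] is c(oo). *)
Definition endpoint c : set (R -> X) :=
  [set c' | geodesic_ray c' /\ asymptotic c c'].

Definition busemann c x : \bar R :=
  limf_esup (fun t : R => (mdist x (c t) - t)%:E) (pinfty_nbhs R).

Definition horoball (p : set (R -> X)) B : Prop :=
  exists c (r : R),
    [/\ geodesic_ray c, endpoint c = p & B = [set x | (busemann c x <= r%:E)%E]].

Definition bounded_hausdorff_dist A B : Prop :=
  exists K : R, (forall a, A a -> exists2 b, B b & mdist a b <= K) /\
                (forall b, B b -> exists2 a, A a & mdist a b <= K).

End HyperbolicSpaces.

Section Actions.
Variables (R : realType) (G : groupType) (X : metricType R).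
Variable act : G -> X -> X.

Definition isometric_action : Prop :=
  [/\ (forall x, act 1%g x = x),
      (forall g h x, act (g * h)%g x = act g (act h x)) &
      (forall g x y, mdist (act g x) (act g y) = mdist x y)].

Definition properly_discontinuous : Prop :=
  forall K : set X, compact K -> finite_set [set g | (act g @` K) `&` K !=set0].

Definition orbit_of (x : X) : set X := range (act ^~ x).

Definition quotient_space : set (set X) := range orbit_of.

Definition quotient_dist (A B : set X) : R :=
  inf [set mdist a b | a in A & b in B].

Definition boundary_act (g : G) (p : set (R -> X)) : set (R -> X) :=
  [set act g \o c | c in p].

Definition isotropy (p : set (R -> X)) : set G := [set g | boundary_act g p = p].

Definition preserves_busemann (H : set G) (c : R -> X) : Prop :=
  forall h x, H h -> busemann c (act h x) = busemann c x.

(* The geodesic rays c_i represent the points at infinity of the lifts of the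
   k rays of the quotient: for some quasi-isometry q from the joined rays to
   X/G, the i-th ray, transported to X/G by q, lifts to a quasi-geodesic r_i
   of X which stays at bounded Hausdorff distance from c_i. *)
Definition lifts_of_quotient_rays (k : nat) (c : 'I_k -> R -> X) : Prop :=
  exists q : 'rV[R]_k -> set X,
    quasi_isometry (@joined_rays_dist _ _) quotient_dist
      (@joined_rays R k) quotient_space q /\
    exists r : 'I_k -> R -> X, forall i,
      [/\ (forall t, 0 <= t -> orbit_of (r i t) = q (half_axis i t)),
          quasi_isometric_embedding (fun s t : R => `|s - t|) (@mdist R X)
            [set t | 0 <= t] (r i) &
          bounded_hausdorff_dist (r i @` [set t | 0 <= t])
            (c i @` [set t | 0 <= t])].

Definition invariant_horoball_system (k : nat) (p : 'I_k -> set (R -> X))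
    (BB : set (set X)) : Prop :=
  [/\ (forall g B, BB B -> BB (act g @` B)),
      trivIset BB id,
      (forall B, BB B -> exists i g, horoball (boundary_act g (p i)) B) &
      (forall i, exists2 B, BB B & horoball (p i) B)].

(* Horoballs being closed, the complement U of their union is open, and its
   cocompactness means that a compact subset of X, not necessarily included
   in U, has translates covering U: a compact subset of U can cover U only if
   U is also closed. *)
Definition cocompact_on (U : set X) : Prop :=
  exists2 K : set X, compact K & U `<=` \bigcup_(g in [set: G]) (act g @` K).

Definition geometrically_finite (k : nat) (H : 'I_k -> set G) : Prop :=
  [/\ isometric_action, properly_discontinuous &
    exists c : 'I_k -> R -> X,
      [/\ (forall i, geodesic_ray (c i)),
          lifts_of_quotient_rays c,
          (forall i, H i = isotropy (endpoint (c i))),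
          (forall i, preserves_busemann (H i) (c i)) &
          exists2 BB : set (set X),
            invariant_horoball_system (fun i => endpoint (c i)) BB &
            cocompact_on (~` \bigcup_(B in BB) B)]].

End Actions.

Definition relatively_hyperbolic (R : realType) (G : groupType) (k : nat)
    (H : 'I_k -> set G) : Prop :=
  (forall i, fin_gen_subgroup (H i)) /\
  exists X : metricType R,
    [/\ proper_space X, geodesic_space X, (exists delta, slim_triangles X delta) &
      exists act : G -> X -> X, geometrically_finite act H].

(* Main.v *)
(* Slim triangles give Gromov's four-point inequality, hence a four-point
   inequality for Busemann functions; all the geometry below is derived from
   these two.  For x, y in G, the center of the triangle with vertices
   o, y o, x o is either close to the orbit of o or deep in a translate of a
   horoball.  In the second case the points where the sides enter the horoball
   are close to a coset of a parabolic subgroup.  In both cases this yields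
   u, v in G such that u o lies near [o, y o] and [o, x o], y v o lies near
   [y o, o] and [y o, x o], and u^-1 y v is trivial or in some H_i.  When y has
   length at most r, there are polynomially many such u, v, because these points
   are close to geodesics, and polynomially many y with given u and v, because
   H_i is undistorted (a word in G is shadowed by its entry points in the
   horoball) and has polynomial growth.  Cauchy-Schwarz over these labels, as in
   Haagerup's inequality, bounds the norm of f * g. *)

Require Import Defs.
From mathcomp Require Import all_boot all_order all_algebra.
From mathcomp Require Import all_classical all_reals all_analysis.
From mathcomp Require Import complex ring lra.

Set Implicit Arguments.
Unset Strict Implicit.
Unset Printing Implicit Defensive.

Import Order.TTheory GRing.Theory Num.Theory.
Import numFieldNormedType.Exports.

Local Open Scope classical_set_scope.
Local Open Scope ring_scope.

(** * Slim triangles and Gromov's four-point inequality *)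

Section FourPoint.
Variables (R : realType) (X : metricType R).
Local Notation d := (@mdist R X).
Implicit Types (x y z w : X).

Definition four_point (D : R) : Prop := forall x y z w,
  d x z + d y w <= Num.max (d x y + d z w) (d x w + d y z) + D.

Lemma four_pointP D : four_point D -> forall x y z w,
  d x z + d y w <= d x y + d z w + D \/ d x z + d y w <= d x w + d y z + D.
Proof.
move=> fp x y z w; have := fp x y z w.
rewrite -lerBlDr le_max => /orP[] h; [left|right]; lra.
Qed.

Lemma geodesic_segment_add x y A n : geodesic_segment x y A -> A n ->
  d x n + d n y = d x y.
Proof.
move=> [c [c0 cd isom ->]] [t /= tI <-].
have d0 := mdist_ge0 x y.
rewrite -[X in d X _]c0 -[X in d _ X + _ = _]/(c t) isom ?lexx //; last first.
rewrite -[in X in _ + X = _]cd isom ?lexx ?d0 ?andbT //.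
rewrite sub0r normrN ger0_norm; last by case/andP: tI.
rewrite distrC ger0_norm; last by case/andP: tI => *; lra.
lra.
Qed.

Lemma geodesic_segment_ends x y A : geodesic_segment x y A -> A x /\ A y.
Proof.
move=> [c [c0 cd _ ->]]; have d0 := mdist_ge0 x y; split.
- by exists 0; rewrite //= lexx.
- by exists (d x y); rewrite //= lexx d0.
Qed.

Lemma slim_ge0 delta x : geodesic_space X -> slim_triangles X delta -> 0 <= delta.
Proof.
move=> geo slim; have [A sA] := geo x x.
have [Ax _] := geodesic_segment_ends sA.
have [b _ h] := slim _ _ _ _ _ _ sA sA sA _ Ax.
exact: le_trans (mdist_ge0 _ _) h.
Qed.

(* The last point of [x, z] close to [y, x] is also close to [z, y]. *)
Lemma slim_center delta x y z A B C : geodesic_space X ->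
  slim_triangles X delta ->
  geodesic_segment x z A -> geodesic_segment z y B -> geodesic_segment y x C ->
  exists m b c', [/\ A m, B b, C c', d m b <= delta + 2 & d m c' <= delta].
Proof.
move=> geo slim sA sB sC; have de0 := slim_ge0 x geo slim.
have [c [c0 cd isom EA]] := sA.
have [Bz _] := geodesic_segment_ends sB.
have [_ Cx] := geodesic_segment_ends sC.
have d0 := mdist_ge0 x z.
pose E := [set t : R | 0 <= t <= d x z /\ exists2 q, C q & d (c t) q <= delta].
have E0 : E 0 by split; [rewrite lexx|exists x; rewrite // c0 mdistxx].
have supE : has_sup E.
  by split; [exists 0|exists (d x z) => t [/andP[]]].
have [t1 Et1 lt1] := sup_adherent (@ltr01 R) supE.
have t1s : t1 <= sup E by apply: sup_ubound => //; case: supE.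
have [t1I [q Cq dq]] := Et1.
have sE : sup E <= d x z by apply: ge_sup => [|t [/andP[]]//]; exists 0.
have [tz|tz] := leP (sup E + 1) (d x z).
(* The point at [sup E + 1] is not close to [[y, x]], so slimness puts it close to [[z, y]]; [c t1]
   is within 2 of it. *)
- have tI : 0 <= sup E + 1 <= d x z by apply/andP; split=> //; case/andP: t1I => *; lra.
  have Am : A (c (sup E + 1)) by rewrite EA; exists (sup E + 1).
  have [b BC db] := slim _ _ _ _ _ _ sA sB sC _ Am.
  have Bb : B b.
    case: BC => // Cb; suff : sup E + 1 <= sup E by move=> h; exfalso; lra.
    apply: sup_ubound; first by case: supE.
    by split=> //; exists b.
  exists (c t1), b, q; split => //; first by rewrite EA; exists t1.
  have := metric_triangle (c t1) (c (sup E + 1)) b.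
  rewrite isom // distrC ger0_norm; lra.
- exists (c t1), z, q; split => //; first by rewrite EA; exists t1.
  rewrite -cd isom ?lexx ?d0 //.
  rewrite distrC ger0_norm; lra.
Qed.

(** A center [m] of the triangle [x z y] lies on [[x, z]], so slimness of [x z w] puts it near
    [[z, w]] or [[w, x]]. Each case gives one term of the maximum, by routing both distances past
    [m]. *)
Lemma slim_four_point delta : geodesic_space X -> slim_triangles X delta ->
  exists2 D, 0 <= D & four_point D.
Proof.
move=> geo slim.
have [[x0]|noX] := pselect (exists x : X, True); last first.
  by exists 0 => // x; case: noX; exists x.
have de0 := slim_ge0 x0 geo slim.
exists (4 * delta + 4) => [|x y z w]; first lra.
have [Axz sxz] := geo x z; have [Azy szy] := geo z y; have [Ayx syx] := geo y x.
have [Azw szw] := geo z w; have [Awx swx] := geo w x.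
have [m [b [c [Am Bb Cc mb mc]]]] := slim_center geo slim sxz szy syx.
have [n BC mn] := slim _ _ _ _ _ _ sxz szw swx _ Am.
have Eb := geodesic_segment_add szy Bb.
have Ec := geodesic_segment_add syx Cc.
rewrite -lerBlDr le_max; apply/orP.
case: BC => Cn.
- left; have En := geodesic_segment_add szw Cn.
  have h1 := metric_triangle x c z; have h2 := metric_triangle c m z.
  have h3 := metric_triangle m n z.
  have h4 := metric_triangle y c w; have h5 := metric_triangle c m w.
  have h6 := metric_triangle m n w.
  move: h1 h2 h3 h4 h5 h6 mb mc mn Eb Ec En.
  rewrite (metric_sym c x) (metric_sym c m) (metric_sym n z) (metric_sym y x) => *.
  lra.
- right; have En := geodesic_segment_add swx Cn.
  have h1 := metric_triangle x n z; have h2 := metric_triangle n m z.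
  have h3 := metric_triangle m b z.
  have h4 := metric_triangle y b w; have h5 := metric_triangle b m w.
  have h6 := metric_triangle m n w.
  move: h1 h2 h3 h4 h5 h6 mb mc mn Eb Ec En.
  rewrite (metric_sym b z) (metric_sym n m) (metric_sym w n) (metric_sym w x)
    (metric_sym z y) (metric_sym b m) (metric_sym y b) (metric_sym n x) => *.
  lra.
Qed.

Lemma geodesic_point x y (s : R) : geodesic_space X -> 0 <= s <= d x y ->
  exists2 m, d x m = s & d m y = d x y - s.
Proof.
move=> geo sI; have [A [c [c0 cd isom _]]] := geo x y.
have d0 := mdist_ge0 x y.
exists (c s).
- rewrite -c0 isom ?lexx // sub0r normrN ger0_norm //; by case/andP: sI.
- rewrite -{1}cd isom ?lexx ?d0 // distrC ger0_norm //; by case/andP: sI => *; lra.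
Qed.

(** Take [m] on [[p, q]] with [d p m] the Gromov product of [q] and [s] at [p]. Both alternatives of
    the four-point inequality then bound [d m s] by the Gromov product of [p] and [q] at [s], plus
    [D]. *)
Lemma triangle_center D p q s : geodesic_space X -> four_point D -> 0 <= D ->
  exists m, [/\ d p m + d m q <= d p q + D, d p m + d m s <= d p s + D
             & d q m + d m s <= d q s + D].
Proof.
move=> geo fp D0.
have t1 := metric_triangle p s q; have t2 := metric_triangle p q s.
have t3 := metric_triangle q p s.
have E1 := metric_sym s q; have E2 := metric_sym p q.
have [|m pm mq] := @geodesic_point p q ((d p q + d p s - d q s) / 2) geo.
  by apply/andP; split; lra.
exists m; have E3 := metric_sym m q.
have [h|h] := four_pointP fp p m q s; split; lra.
Qed.

End FourPoint.

(** * Busemann functions and their four-point inequality *)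

Section Busemann.
Variables (R : realType) (X : metricType R).
Local Notation d := (@mdist R X).
Implicit Types (x y z w : X) (c : R -> X).

(** Real-valued form of [busemann]: along a ray, [d x (c t) - t] is nonincreasing in [t], so its
    upper limit is its infimum. *)
Definition beta c x : R := inf [set d x (c t) - t | t in [set t | 0 <= t]].

Lemma beta_has_inf c x : geodesic_ray c ->
  has_inf [set d x (c t) - t | t in [set t | 0 <= t]].
Proof.
move=> ray; split; first by exists (d x (c 0) - 0), 0; rewrite /=.
exists (- d x (c 0)) => _ [t /= t0 <-].
have := metric_triangle (c 0) x (c t); rewrite ray // sub0r normrN ger0_norm //.
rewrite (metric_sym _ x); lra.
Qed.

Lemma beta_le c x t : geodesic_ray c -> 0 <= t -> beta c x <= d x (c t) - t.
Proof.
move=> ray t0; apply: ge_inf; first by case: (beta_has_inf x ray).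
by exists t.
Qed.

Lemma beta_approx c x e : geodesic_ray c -> 0 < e ->
  exists2 T, 0 <= T & forall t, T <= t -> d x (c t) - t < beta c x + e.
Proof.
move=> ray e0; have [_ [T /= T0 <-] hT] := inf_adherent e0 (beta_has_inf x ray).
exists T => // t Tt; apply: le_lt_trans hT.
have := metric_triangle x (c T) (c t); rewrite ray //; last lra.
rewrite distrC ger0_norm; lra.
Qed.

Lemma busemannE c x : geodesic_ray c -> busemann c x = (beta c x)%:E.
Proof.
move=> ray; rewrite /busemann limf_esupE; apply/eqP; rewrite eq_le; apply/andP; split.
- apply/lee_addgt0Pr => e e0.
  have [T T0 hT] := beta_approx x ray e0.
  apply: ereal_inf_le => /=.
  exists (ereal_sup ((fun t => (d x (c t) - t)%:E) @` [set t | T < t])).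
    exists [set t | T < t] => //; exists T; split => //; exact: num_real.
  apply: ge_ereal_sup => _ [t /= Tt <-].
  by rewrite lee_fin ltW // hT // ltW.
- apply: le_ereal_inf_tmp => _ [V [M [_ MV]] <-].
  (* [Num.max 0 M + 1] lies in [V] and is nonnegative, as [beta_le] needs. *)
  apply: le_trans (_ : (d x (c (Num.max 0 M + 1)) - (Num.max 0 M + 1))%:E <= _)%E.
    rewrite lee_fin; apply: beta_le => //.
    have : 0 <= Num.max 0 M by rewrite le_max lexx.
    lra.
  apply: ereal_sup_ubound; exists (Num.max 0 M + 1) => //.
  apply: MV => /=.
  have : M <= Num.max 0 M by rewrite le_max lexx orbT.
  lra.
Qed.

Lemma beta_lip c x y : geodesic_ray c -> beta c x <= beta c y + d x y.
Proof.
move=> ray; apply/ler_addgt0Pr => e e0.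
have [T T0 hT] := beta_approx y ray e0.
have := beta_le x ray T0; have := hT T (lexx _).
have := metric_triangle x y (c T); lra.
Qed.

Lemma beta_ray c t : geodesic_ray c -> 0 <= t -> beta c (c t) <= - t.
Proof. by move=> ray t0; have := beta_le (c t) ray t0; rewrite mdistxx sub0r. Qed.

(** Take the point at distance [s] from [x] on a geodesic to [c t], for [t] large. The error 1 comes
    from approximating the infimum. *)
Lemma beta_descend c x s : geodesic_space X -> geodesic_ray c -> 0 <= s ->
  exists2 a, d x a = s & beta c a <= beta c x - s + 1.
Proof.
move=> geo ray s0; have [T T0 hT] := beta_approx x ray (@ltr01 R).
set b0 := beta c x in hT *; pose t := T + s + `|b0|.
have a0 : 0 <= `|b0| by []. have b0a : - `|b0| <= b0 by rewrite lerNl -normrN ler_norm.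
have Tt : T <= t by rewrite /t; lra.
have ht := hT t Tt.
have t0 : 0 <= t by lra.
have bt := beta_le x ray t0; rewrite -/b0 in bt.
have [|a xa ac] := @geodesic_point _ _ x (c t) s geo.
  apply/andP; split=> //; rewrite /t in bt ht *; lra.
exists a => //; have := beta_le a ray t0; lra.
Qed.

Section Hyperbolic.
Variable D : R.
Hypothesis fp : four_point X D.

(** Limit of the four-point inequality for [x], [y], [z], [c t] as [t] grows. The valid alternative
    may depend on [t], so the proof is by contradiction, with [e] the smaller of the two defects. *)
Lemma beta_four_point c x y z : geodesic_ray c ->
  d x z + beta c y <= d x y + beta c z + D \/
  d x z + beta c y <= d y z + beta c x + D.
Proof.
move=> ray; apply/orP; apply: contraT.
rewrite negb_or -!ltNge => /andP[h1 h2].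
pose e := Num.min (d x z + beta c y - (d x y + beta c z + D))
                  (d x z + beta c y - (d y z + beta c x + D)).
have e0 : 0 < e by rewrite lt_min; apply/andP; split; lra.
have [T1 T10 hT1] := beta_approx x ray e0.
have [T2 T20 hT2] := beta_approx z ray e0.
have hx := hT1 (T1 + T2) ltac:(lra); have hz := hT2 (T1 + T2) ltac:(lra).
have hy := beta_le y ray (t := T1 + T2) ltac:(lra).
have e1 : e <= d x z + beta c y - (d x y + beta c z + D) by rewrite ge_min lexx.
have e2 : e <= d x z + beta c y - (d y z + beta c x + D) by rewrite ge_min lexx orbT.
by have [h|h] := four_pointP fp x y z (c (T1 + T2)); lra.
Qed.

(** In the four-point inequality for [x], [y], [c t], [c' t], the alternative with [d (c t) (c' t)]
    is bounded while the left side grows like [2 * t]; for large [t] only the other one remains. *)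
Lemma beta_asymptotic c c' x y : geodesic_ray c -> geodesic_ray c' ->
  asymptotic c c' -> beta c x + beta c' y <= beta c' x + beta c y + D.
Proof.
move=> ray ray' [K hK]; apply/ler_addgt0Pr => e e0.
have e20 : 0 < e / 2 by lra.
have [T1 T10 hT1] := beta_approx x ray' e20.
have [T2 T20 hT2] := beta_approx y ray e20.
pose t := T1 + T2 + `|K| + d x y + `|beta c x| + `|beta c' y| + `|D| + 1.
have K0 := ler_norm K; have D1 := ler_norm D.
have b1 : - `|beta c x| <= beta c x by rewrite lerNl -normrN ler_norm.
have b2 : - `|beta c' y| <= beta c' y by rewrite lerNl -normrN ler_norm.
have d0 := mdist_ge0 x y.
have n1 : 0 <= `|K| by []. have n2 : 0 <= `|beta c x| by [].
have n3 : 0 <= `|beta c' y| by []. have n4 : 0 <= `|D| by [].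
have t0 : 0 <= t by rewrite /t; lra.
have h1 := hT1 t ltac:(rewrite /t; lra); have h2 := hT2 t ltac:(rewrite /t; lra).
have h3 := beta_le x ray t0; have h4 := beta_le y ray' t0.
have h5 := hK t t0.
have [h|h] := four_pointP fp x y (c t) (c' t); last lra.
have : 2 * t <= d x y + K + D - beta c x - beta c' y by lra.
rewrite /t; lra.
Qed.

(* A ray on which the Busemann function is bounded above converges to the
   center of the horoballs. *)
Lemma beta_ray_descends c c' rho t : geodesic_ray c -> geodesic_ray c' ->
  (forall s, 0 <= s -> beta c (c' s) <= rho) -> 0 <= t ->
  beta c (c' t) <= beta c (c' 0) - t + D.
Proof.
move=> ray ray' hrho t0.
(* [T] is too large for the first alternative of [beta_four_point], since [beta c (c' T)] is at most
   [rho]; the second one is the claim. *)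
pose T := t + `|rho + D - beta c (c' t)| + 1.
have n0 : 0 <= `|rho + D - beta c (c' t)| by [].
have n1 := ler_norm (rho + D - beta c (c' t)).
have T0 : 0 <= T by rewrite /T; lra.
have hT := hrho T T0.
have := beta_four_point (c' 0) (c' t) (c' T) ray.
rewrite !ray' // !sub0r !normrN (ger0_norm t0) (ger0_norm T0) distrC ger0_norm.
  by rewrite /T in hT *; case; lra.
rewrite /T; lra.
Qed.

(** From [c' t0] on, [c'] goes down at unit speed up to [D], and so does [c]; [beta_four_point] then
    keeps [c' (t0 + t)] at bounded distance from [c t]. *)
Lemma beta_bounded_asymptotic c c' t0 rho : geodesic_ray c -> geodesic_ray c' ->
  0 <= t0 -> (forall s, t0 <= s -> beta c (c' s) <= rho) -> asymptotic c c'.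
Proof.
move=> ray ray' t00 hrho.
have ray'' : geodesic_ray (fun t => c' (t0 + t)).
  move=> s t s0 t1; rewrite ray'; [congr `|_|; lra|lra|lra].
pose o := c' t0; set b := beta c o.
have hdesc t : 0 <= t -> beta c (c' (t0 + t)) <= b - t + D.
  move=> h; have := @beta_ray_descends c _ rho t ray ray'' _ h.
  rewrite addr0 => -> // s s0; apply: hrho; lra.
exists (`|D| + `|d o (c 0) + D + D| + `|b| + t0) => t tt.
have nD := ler_norm D; have nb : - `|b| <= b by rewrite lerNl -normrN ler_norm.
have ndD := ler_norm (d o (c 0) + D + D).
have n1 : 0 <= `|D| by []. have n2 : 0 <= `|d o (c 0) + D + D| by [].
have n3 : 0 <= `|b| by [].
have h1 := hdesc t tt.
have h2 := beta_ray ray tt.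
have E1 : d (c' (t0 + t)) o = t.
  rewrite /o ray' //; last lra.
  rewrite ger0_norm; lra.
have E2 : d o (c t) <= d o (c 0) + t.
  have := metric_triangle o (c 0) (c t); rewrite ray // sub0r normrN ger0_norm //.
have E3 : d (c' (t0 + t)) (c' t) = t0.
  rewrite ray' //; last lra.
  rewrite ger0_norm; lra.
have E4 := metric_triangle (c t) (c' (t0 + t)) (c' t).
have E5 := metric_sym (c t) (c' (t0 + t)).
have [h|h] := beta_four_point (c' (t0 + t)) o (c t) ray; rewrite -/b in h; lra.
Qed.

End Hyperbolic.
End Busemann.

(** * Cauchy-Schwarz and sums over fibers *)

Lemma sqr_sum_mul_le (R : realDomainType) (I : Type) (s : seq I) (f g : I -> R) :
  (\sum_(i <- s) f i * g i) ^+ 2 <= (\sum_(i <- s) f i ^+ 2) * (\sum_(i <- s) g i ^+ 2).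
Proof.
(* Lagrange's identity: twice the difference is a double sum of squares. *)
rewrite -subr_ge0 -(pmulr_rge0 _ (ltr0n R 2)) mulr_natl mulr2n expr2 !big_distrlr /=.
rewrite [X in X - _ + _]exchange_big /= -!sumrB -big_split /=.
apply: sumr_ge0 => i _; rewrite -!sumrB -big_split /=; apply: sumr_ge0 => j _.
suff -> : f j ^+ 2 * g i ^+ 2 - f i * g i * (f j * g j) +
   (f i ^+ 2 * g j ^+ 2 - f i * g i * (f j * g j)) = (f i * g j - f j * g i) ^+ 2.
  exact: sqr_ge0.
ring.
Qed.

Lemma sqr_sum_le (R : realDomainType) (I : Type) (s : seq I) (f : I -> R) :
  (\sum_(i <- s) f i) ^+ 2 <= (size s)%:R * \sum_(i <- s) f i ^+ 2.
Proof.
have := sqr_sum_mul_le s f (fun=> 1).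
under eq_bigr do rewrite mulr1.
under [X in _ * X]eq_bigr do rewrite expr1n.
by rewrite big_const_seq count_predT iter_addr_0 mulrC.
Qed.

Lemma sum_pred1_seq (V : nmodType) (I : eqType) (s : seq I) (F : I -> V) i :
  uniq s -> \sum_(j <- s | j == i) F j = if i \in s then F i else 0.
Proof.
move=> us; case: ifP => si.
  by rewrite -big_filter (filter_pred1_uniq us si) big_seq1.
rewrite big_seq_cond big_pred0 // => j.
by case: eqP => [->|]; rewrite ?si ?andbF.
Qed.

Lemma sum_fibers (V : nmodType) (I J : eqType) (s : seq I) (t : seq J)
    (l : I -> J) (F : I -> V) : uniq t -> {in s, forall i, l i \in t} ->
  \sum_(i <- s) F i = \sum_(j <- t) \sum_(i <- s | l i == j) F i.
Proof.
move=> ut lt; rewrite (exchange_big_dep xpredT) //=.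
rewrite !big_seq; apply: eq_bigr => i si.
under eq_bigl => j do rewrite eq_sym.
by rewrite sum_pred1_seq // lt.
Qed.

Lemma sum_const_count (R : pzSemiRingType) (I : Type) (s : seq I) (P : pred I) (x : R) :
  \sum_(i <- s | P i) x = (count P s)%:R * x.
Proof. by rewrite big_const_seq iter_addr_0 mulr_natl. Qed.

Lemma uniq_count_le (T : eqType) (s t : seq T) (P : pred T) : uniq s ->
  (forall x, x \in s -> P x -> x \in t) -> (count P s <= size t)%N.
Proof.
move=> us st; rewrite -size_filter; apply: uniq_leq_size; first exact: filter_uniq.
by move=> x; rewrite mem_filter => /andP[Px xs]; exact: st.
Qed.

Lemma size_flatten_le (S T : eqType) (s : seq S) (f : S -> seq T) M :
  {in s, forall x, size (f x) <= M}%N -> (size (flatten [seq f x | x <- s]) <= size s * M)%N.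
Proof.
elim: s => //= x s IH h; rewrite size_cat mulSn leq_add ?h ?mem_head //.
by apply: IH => y ys; rewrite h // inE ys orbT.
Qed.

(** * Haagerup-type bound for a convolution, from labels on pairs *)

Section ConvolutionBound.
Variables (R : realDomainType) (G : groupType) (L : eqType).
Variables (X Y Z : seq G) (U V : G -> G -> L) (M : nat) (a b : G -> R).
Hypothesis X_uniq : uniq X.
Hypothesis Y_uniq : uniq Y.
Hypothesis Z_uniq : uniq Z.
Hypothesis YXZ : {in X & Y, forall x y, (y^-1 * x)%g \in Z}.
Hypothesis U_x : {in X, forall x, exists2 s : seq L, (size s <= M)%N &
  {in Y, forall y, U x y \in s}}.
Hypothesis U_y : {in Y, forall y, exists2 s : seq L, (size s <= M)%N &
  {in X, forall x, U x y \in s}}.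
Hypothesis V_z : forall z, exists2 s : seq L, (size s <= M)%N &
  {in X & Y, forall x y, (y^-1 * x)%g = z -> V x y \in s}.
Hypothesis UV : forall u v, exists2 s : seq G, (size s <= M)%N &
  {in X & Y, forall x y, U x y = u -> V x y = v -> y \in s}.

(** Dominates, for all [x] in [X] at once, the weight of [a] on the [y] with [U x y = u]. *)
Let A u : R := \sum_(y <- Y | has (fun x => U x y == u) X) a y ^+ 2.
Let W := undup [seq U x y | x <- X, y <- Y].

Let A_ge0 u : 0 <= A u.
Proof. by apply: sumr_ge0 => y _; exact: sqr_ge0. Qed.

(** By [U_y], each [y] contributes to at most [M] of the [A u]. *)
Let sum_A : \sum_(u <- W) A u <= M%:R * \sum_(y <- Y) a y ^+ 2.
Proof.
rewrite /A (exchange_big_dep xpredT) //= mulr_sumr !big_seq.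
apply: ler_sum => y yY; rewrite sum_const_count ler_wpM2r ?sqr_ge0 // ler_nat.
have [s sM hs] := U_y yY; apply: leq_trans sM; apply: uniq_count_le.
  exact: undup_uniq.
by move=> u _ /hasP[x xX /eqP <-]; exact: hs.
Qed.

(** Group the [y] by the label [U x y], which has at most [M] values. Cauchy-Schwarz over the labels
    costs [M]; inside one label it separates [a] from [b], and the factor of [a] is at most
    [A u]. *)
Let fiber_x x : x \in X -> (\sum_(y <- Y) a y * b (y^-1 * x)%g) ^+ 2 <=
  M%:R * \sum_(y <- Y) A (U x y) * b (y^-1 * x)%g ^+ 2.
Proof.
move=> xX; have [s sM hs] := U_x xX.
have us := undup_uniq s.
have hs' : {in Y, forall y, U x y \in undup s}.
  by move=> y yY; rewrite mem_undup hs.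
rewrite (sum_fibers _ us hs') (sum_fibers (fun y => A (U x y) * _) us hs').
apply: le_trans (sqr_sum_le _ _) _; apply: ler_pM => //.
- by apply: sumr_ge0 => u _; exact: sqr_ge0.
- rewrite ler_nat; apply: leq_trans sM; exact: size_undup.
apply: ler_sum => u _.
have -> : \sum_(y <- Y | U x y == u) A (U x y) * b (y^-1 * x)%g ^+ 2 =
    A u * \sum_(y <- Y | U x y == u) b (y^-1 * x)%g ^+ 2.
  by rewrite mulr_sumr; apply: eq_bigr => y /eqP ->.
rewrite -[X in X ^+ 2 <= _]big_filter -[X in _ <= _ * X]big_filter.
apply: le_trans (sqr_sum_mul_le _ _ _) _; apply: ler_wpM2r.
  by apply: sumr_ge0 => y _; exact: sqr_ge0.
rewrite big_filter /A big_mkcond [X in _ <= X]big_mkcond.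
apply: ler_sum => y _; case: ifP => h; last by case: ifP => // _; exact: sqr_ge0.
by rewrite (introT hasP) //; exists x.
Qed.

(** For fixed [z], [x] is [y * z]. At most [M] labels [v] occur, and [u], [v] leave at most [M]
    choices of [y], so each [A u] is counted at most [M ^ 2] times. *)
Let fiber_z z : \sum_(y <- Y) \sum_(x <- X | (y^-1 * x)%g == z) A (U x y) <=
  M%:R ^+ 2 * \sum_(u <- W) A u.
Proof.
have -> : \sum_(y <- Y) \sum_(x <- X | (y^-1 * x)%g == z) A (U x y) =
    \sum_(y <- [seq y <- Y | (y * z)%g \in X]) A (U (y * z)%g y).
  rewrite big_filter [RHS]big_mkcond; apply: eq_bigr => y _.
  have E x : ((y^-1 * x)%g == z) = (x == (y * z)%g).
    by apply/eqP/eqP => [<-|->]; rewrite ?mulVKg ?mulKg.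
  under eq_bigl => x do rewrite E.
  exact: sum_pred1_seq.
set Q := [seq y <- Y | _].
have hQ : {in Q, forall y, U (y * z)%g y \in W}.
  move=> y; rewrite mem_filter mem_undup => /andP[h1 h2].
  by apply/allpairsP; exists ((y * z)%g, y).
rewrite (sum_fibers _ (undup_uniq _) hQ) mulr_sumr; apply: ler_sum => u _.
under eq_bigr => y /eqP -> do [].
rewrite sum_const_count ler_wpM2r // -natrX ler_nat.
have [s sM hs] := V_z z.
have /choice[t ht] : forall v, exists s : seq G, (size s <= M)%N /\
    {in X & Y, forall x y, U x y = u -> V x y = v -> y \in s}.
  by move=> v; have [s' ? ?] := UV u v; exists s'.
apply: leq_trans (_ : size (flatten [seq t v | v <- s]) <= _)%N; last first.
  apply: leq_trans (size_flatten_le (M := M) _) _; first by move=> v _; case: (ht v).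
  by rewrite expnS expn1 leq_mul2r sM orbT.
apply: uniq_count_le; first exact: filter_uniq.
move=> y; rewrite mem_filter => /andP[yzX yY] /eqP Uu.
apply/flattenP; exists (t (V (y * z)%g y)); last first.
  by case: (ht (V (y * z)%g y)) => _ h; apply: (h (y * z)%g).
by apply: map_f; apply: hs => //; rewrite mulKg.
Qed.

(** The exponent 4 collects [M] from [fiber_x], [M ^ 2] from [fiber_z] and [M] from [sum_A]. *)
Lemma convolution_bound :
  \sum_(x <- X) (\sum_(y <- Y) a y * b (y^-1 * x)%g) ^+ 2 <=
  M%:R ^+ 4 * (\sum_(y <- Y) a y ^+ 2) * (\sum_(z <- Z) b z ^+ 2).
Proof.
apply: le_trans (_ : M%:R * \sum_(x <- X) \sum_(y <- Y)
    A (U x y) * b (y^-1 * x)%g ^+ 2 <= _).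
  rewrite mulr_sumr !big_seq; apply: ler_sum => x; exact: fiber_x.
rewrite exchange_big /=.
have -> : \sum_(y <- Y) \sum_(x <- X) A (U x y) * b (y^-1 * x)%g ^+ 2 =
    \sum_(z <- Z) b z ^+ 2 * \sum_(y <- Y) \sum_(x <- X | (y^-1 * x)%g == z) A (U x y).
  under [RHS]eq_bigr => z _ do rewrite mulr_sumr.
  rewrite [RHS]exchange_big /= !big_seq; apply: eq_bigr => y yY.
  rewrite (sum_fibers (l := fun x => (y^-1 * x)%g) _ Z_uniq); last first.
    by move=> x xX; exact: YXZ.
  apply: eq_bigr => z _; rewrite mulr_sumr; apply: eq_bigr => x /eqP ->.
  by rewrite mulrC.
have M0 : 0 <= M%:R :> R by [].
set S2 := \sum_(y <- Y) a y ^+ 2; set S3 := \sum_(z <- Z) b z ^+ 2.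
have -> : M%:R ^+ 4 * S2 * S3 = M%:R * (S3 * (M%:R ^+ 3 * S2)) by ring.
rewrite ler_wpM2l // mulr_suml; apply: ler_sum => z _; rewrite ler_wpM2l ?sqr_ge0 //.
apply: le_trans (fiber_z z) _.
have -> : M%:R ^+ 3 * S2 = M%:R ^+ 2 * (M%:R * S2) by ring.
by rewrite ler_wpM2l ?exprn_ge0 // sum_A.
Qed.

End ConvolutionBound.

(** * Constants uniform over a finite family *)

Lemma seq_uniform_bound (R : realType) (T : eqType) (s : seq T) (P : T -> R -> Prop) :
  (forall x a b, a <= b -> P x a -> P x b) -> (forall x, x \in s -> exists a, P x a) ->
  exists2 a, 0 <= a & forall x, x \in s -> P x a.
Proof.
move=> mono; elim: s => [|x s IH] hs; first by exists 0.
have [a Pa] := hs x (mem_head _ _).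
have [y ys|b b0 Pb] := IH; first by apply: hs; rewrite inE ys orbT.
have a0 : 0 <= `|a| by [].
have la := ler_norm a.
exists (b + `|a|) => [|y]; first lra.
rewrite inE => /orP[/eqP ->|ys]; first by apply: mono Pa; lra.
by apply: mono (Pb _ ys); lra.
Qed.

Lemma ord_uniform_bound (R : realType) k (P : 'I_k -> R -> Prop) :
  (forall i a b, a <= b -> P i a -> P i b) -> (forall i, exists a, P i a) ->
  exists2 a, 0 <= a & forall i, P i a.
Proof.
move=> mono hP; have [a a0 Pa] := seq_uniform_bound (s := enum 'I_k) mono (fun i _ => hP i).
by exists a => // i; apply: Pa; rewrite mem_enum.
Qed.

(** * Words and word length *)

Section Words.
Variables (R : realType) (G : groupType).
Implicit Types (S : set G) (g h : G) (w : seq G).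

Lemma word_for_cat S g h w w' :
  word_for S g w -> word_for S h w' -> word_for S (g * h)%g (w ++ w').
Proof.
move=> [wS wg] [wS' wh]; split; last by rewrite big_cat /= wg wh.
by move=> x; rewrite mem_cat => /orP[/wS|/wS'].
Qed.

Lemma word_for_cons S x g w : word_for S g (x :: w) ->
  (S x \/ S x^-1%g) /\ exists2 g', g = (x * g')%g & word_for S g' w.
Proof.
move=> [wS <-]; rewrite big_cons; split; first by apply: wS; rewrite mem_head.
exists (\prod_(y <- w) y)%g => //; split => // y yw.
by apply: wS; rewrite inE yw orbT.
Qed.

Lemma word_length_le S g w : word_for S g w -> word_length R S g <= (size w)%:R.
Proof.
move=> wg; apply: ge_inf; last by exists w.
by exists 0 => _ [w' _ <-].
Qed.

(** The slack 1 comes from approaching the infimum rather than attaining it. *)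
Lemma word_length_word S g (r : R) : generated S g -> word_length R S g <= r ->
  exists2 w, word_for S g w & (size w)%:R <= r + 1.
Proof.
move=> [w0 w0g] gr.
have hinf : has_inf [set ((size w)%:R : R) | w in [set w | word_for S g w]].
  by split; [exists (size w0)%:R, w0|exists 0 => _ [w' _ <-]].
have [_ [w wg <-] wr] := inf_adherent (@ltr01 R) hinf.
by exists w => //; apply: le_trans (ltW wr) _; rewrite lerD2r.
Qed.

Lemma finite_word_bound S (F : set G) : finite_set F -> F `<=` generated S ->
  exists2 a : R, 0 <= a &
    forall g, F g -> exists2 w, word_for S g w & (size w)%:R <= a.
Proof.
move=> /finite_seqP[s ->] FS.
apply: (seq_uniform_bound (P := fun g a => exists2 w, word_for S g w & (size w)%:R <= a)).
  by move=> g a b ab [w wg wa]; exists w => //; exact: le_trans ab.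
by move=> g gs; have [w wg] := FS g gs; exists (size w)%:R, w.
Qed.

End Words.

(** * Isometric actions, stabilizers of boundary points, proper spaces *)

Section IsometricAction.
Variables (R : realType) (G : groupType) (X : metricType R) (act : G -> X -> X).
Local Notation d := (@mdist R X).
Hypothesis isom : isometric_action act.

Lemma act1 x : act 1%g x = x. Proof. by case: isom. Qed.
Lemma actM g h x : act (g * h)%g x = act g (act h x). Proof. by case: isom. Qed.
Lemma act_mdist g x y : d (act g x) (act g y) = d x y. Proof. by case: isom. Qed.
Lemma actK g x : act g^-1%g (act g x) = x. Proof. by rewrite -actM mulVg act1. Qed.
Lemma actVK g x : act g (act g^-1%g x) = x. Proof. by rewrite -actM mulgV act1. Qed.
Lemma act_mdistV g x y : d (act g x) y = d x (act g^-1%g y).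
Proof. by rewrite -(act_mdist g^-1%g) actK. Qed.

Lemma act_ray g c : geodesic_ray c -> geodesic_ray (act g \o c).
Proof. by move=> ray s t s0 t0; rewrite /= act_mdist ray. Qed.

Lemma boundary_actM g h p :
  boundary_act act (g * h)%g p = boundary_act act g (boundary_act act h p).
Proof.
apply/seteqP; split => [_ [c pc <-]|_ [_ [c pc <-] <-]].
- exists (act h \o c); first by exists c.
  by apply/funext => t /=; rewrite actM.
- by exists c => //; apply/funext => t /=; rewrite actM.
Qed.

Lemma isotropy1 p : isotropy act p 1%g.
Proof.
apply/seteqP; split => [_ [c pc <-]|c pc].
- by rewrite (_ : _ \o c = c) //; apply/funext => t /=; rewrite act1.
- by exists c => //; apply/funext => t /=; rewrite act1.
Qed.

Lemma isotropyM p g h : isotropy act p g -> isotropy act p h -> isotropy act p (g * h)%g.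
Proof. by rewrite /isotropy /= => pg ph; rewrite boundary_actM ph pg. Qed.

Lemma isotropyV p g : isotropy act p g -> isotropy act p g^-1%g.
Proof.
rewrite /isotropy /= => pg; rewrite -{1}pg -boundary_actM mulVg.
exact: isotropy1.
Qed.

Lemma asymptotic_sym (c c' : R -> X) : asymptotic c c' -> asymptotic c' c.
Proof. by move=> [K hK]; exists K => t t0; rewrite metric_sym hK. Qed.

Lemma asymptotic_trans (c2 c1 c3 : R -> X) :
  asymptotic c1 c2 -> asymptotic c2 c3 -> asymptotic c1 c3.
Proof.
move=> [K hK] [L hL]; exists (K + L) => t t0.
by apply: le_trans (metric_triangle _ (c2 t) _) _; rewrite lerD ?hK ?hL.
Qed.

Lemma asymptotic_act g c c' : asymptotic c c' -> asymptotic (act g \o c) (act g \o c').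
Proof. by move=> [K hK]; exists K => t t0 /=; rewrite act_mdist hK. Qed.

Lemma asymptotic_isotropy g c : geodesic_ray c -> asymptotic c (act g \o c) ->
  isotropy act (endpoint c) g.
Proof.
move=> ray as1; apply/seteqP; split => [_ [c' [ray' as2] <-]|c' [ray' as2]].
- split; first exact: act_ray.
  exact: asymptotic_trans as1 (asymptotic_act g as2).
- exists (act g^-1%g \o c'); last by apply/funext => t /=; rewrite actVK.
  split; first exact: act_ray.
  have as3 := asymptotic_act g^-1%g (asymptotic_trans (asymptotic_sym as1) as2).
  have <- // : act g^-1%g \o (act g \o c) = c.
  by apply/funext => t /=; rewrite actK.
Qed.

Lemma proper_finite (o : X) (r : R) : proper_space X -> properly_discontinuous act ->
  finite_set [set g | d o (act g o) <= r].
Proof.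
move=> prop pd; apply: sub_finite_set (pd _ (prop o r)) => g /= hg.
exists (act g o); split => //; exists o => //=.
by rewrite mdistxx; apply: le_trans hg; exact: mdist_ge0.
Qed.

(** Compactness in its near-covering form, for the filter on finite lists generated by the lists
    containing a given one: a list containing [x] serves the whole ball of radius [1 / 2] around
    [x]. *)
Lemma proper_net (o : X) (r : R) : proper_space X ->
  exists s : seq X, forall y, d o y <= r -> exists2 n, n \in s & d n y < 1 / 2.
Proof.
move=> prop.
pose F : set_system (seq X) :=
  [set S : set (seq X) | exists s0 : seq X, forall s : seq X, {subset s0 <= s} -> S s].
have FF : Filter F.
  split=> [|P Q [s1 h1] [s2 h2]|P Q PQ [s1 h1]]; first by exists [::].
  - exists (s1 ++ s2) => s hs; split; [apply: h1|apply: h2] => y ys.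
      by apply: hs; rewrite mem_cat ys.
    by apply: hs; rewrite mem_cat ys orbT.
  - by exists s1 => s hs; apply: PQ; apply: h1.
pose P (s : seq X) y := exists2 n, n \in s & d n y < 1 / 2.
have [x /= xr|s0 hs0] := (iffLR (compact_near_coveringP _) (prop o r)) (seq X) F P FF.
  have half : 0 < 1 / 2 :> R by lra.
  exists (ball x (1 / 2), [set s : seq X | x \in s]).
    split; first exact: nbhsx_ballx.
    by exists [:: x] => s; apply; rewrite mem_head.
  by move=> [y s] [/=]; rewrite ballEmdist /= => xy xs; exists x.
by exists s0 => y oy; exact: (hs0 s0 (fun _ => id) y oy).
Qed.

End IsometricAction.

(** * Parabolic subgroups and horoballs *)

Section Parabolic.
Variables (R : realType) (G : groupType) (X : metricType R) (act : G -> X -> X).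
Local Notation d := (@mdist R X).
Variables (k : nat) (H : 'I_k -> set G) (c : 'I_k -> R -> X) (D : R) (o : X).
Hypothesis isom : isometric_action act.
Hypothesis pd : properly_discontinuous act.
Hypothesis proper : proper_space X.
Hypothesis geo : geodesic_space X.
Hypothesis D0 : 0 <= D.
Hypothesis fp : four_point X D.
Hypothesis ray : forall i, geodesic_ray (c i).
Hypothesis lifts : lifts_of_quotient_rays act c.
Hypothesis HE : forall i, H i = isotropy act (endpoint (c i)).
Hypothesis HB : forall i, preserves_busemann act (H i) (c i).
Variable BB : set (set X).
Hypothesis inv : invariant_horoball_system act (fun i => endpoint (c i)) BB.

Local Notation b i := (beta (c i)).

Lemma parabolic1 i : H i 1%g. Proof. by rewrite HE; exact: isotropy1. Qed.
Lemma parabolicM i g h : H i g -> H i h -> H i (g * h)%g.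
Proof. rewrite HE; exact: isotropyM. Qed.
Lemma parabolicV i g : H i g -> H i g^-1%g.
Proof. rewrite HE; exact: isotropyV. Qed.

Lemma beta_H i h x : H i h -> b i (act h x) = b i x.
Proof.
move=> Hh; apply: EFin_inj; rewrite -!busemannE //; exact: HB.
Qed.

(** The orbit of [x] is near the image under [q] of the joining point, hence near that of [o], or
    near the image of a point of a half-axis, whose lift [r i t] is near [c i]. *)
Lemma near_orbit_or_rays : exists2 C, 0 <= C & forall x,
  (exists g, d x (act g o) <= C) \/
  exists g i t, 0 <= t /\ d x (act g (c i t)) <= C.
Proof.
have [q [[qs _ [C hC]] [r hr]]] := lifts.
have [K K0 hK] : exists2 K, 0 <= K & forall i t, 0 <= t ->
    exists2 s, 0 <= s & d (r i t) (c i s) <= K.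
  pose P i K := forall t, 0 <= t -> exists2 s, 0 <= s & d (r i t) (c i s) <= K.
  apply: (@ord_uniform_bound R k P) => [i a b' ab Pa t t0|i].
    by have [s s0 h] := Pa t t0; exists s => //; exact: le_trans ab.
  have [_ _ [K [hK _]]] := hr i; exists K => t t0.
  by have [|_ [s /= s0 <-] h] := hK (r i t); [exists t|exists s].
have [x1 _ q0] := qs 0 (or_introl erefl).
exists (`|C| + 1 + K + d x1 o) => [|x].
  by have := mdist_ge0 x1 o; have : 0 <= `|C| by []; lra.
have [|v jv qv] := hC (orbit_of act x); first by exists x.
have [x2 _ qx2] := qs v jv.
have hinf : has_inf [set mdist a b | a in q v & b in orbit_of act x].
  split; last by exists 0 => _ [a _] [b' _] <-; exact: mdist_ge0.
  exists (d (act 1%g x2) (act 1%g x)); exists (act 1%g x2).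
    by rewrite -qx2; exists 1%g.
  by exists (act 1%g x) => //; exists 1%g.
(* The quotient distance is an infimum; choosing representatives costs 1. *)
have [_ [a qa] [_ [g _ <-] <-] dab] := inf_adherent (@ltr01 R) hinf.
have {dab} dab : d a (act g x) < `|C| + 1.
  apply: lt_le_trans dab _; rewrite lerD2r; exact: le_trans qv (ler_norm _).
have dx1 := mdist_ge0 x1 o.
case: jv => [v0|[i _ [t /= t0 vE]]].
- left; move: qa; rewrite v0 -q0 => -[g' _ /= ag]; subst a.
  exists (g^-1 * g')%g.
  rewrite (actM isom).
  have h : d x (act g^-1%g (act g' x1)) < `|C| + 1.
    by rewrite metric_sym act_mdistV // invgK.
  have := metric_triangle x (act g^-1%g (act g' x1)) (act g^-1%g (act g' o)).
  rewrite (act_mdist isom g^-1%g) (act_mdist isom) => h2.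
  lra.
- right; have [rt _ _] := hr i.
  move: qa; rewrite -vE -rt // => -[g' _ /= ag]; subst a.
  have [s s0 hs] := hK i t t0.
  exists (g^-1 * g')%g, i, s; split=> //.
  rewrite (actM isom).
  have h : d x (act g^-1%g (act g' (r i t))) < `|C| + 1.
    by rewrite metric_sym act_mdistV // invgK.
  have := metric_triangle x (act g^-1%g (act g' (r i t))) (act g^-1%g (act g' (c i s))).
  rewrite (act_mdist isom g^-1%g) (act_mdist isom) => h2.
  lra.
Qed.

(* The horoballs of the invariant system, up to a bounded change of level. *)
Lemma horoball_sets : exists (rho : R) (B : 'I_k -> set X), [/\ 0 <= rho,
  (forall i x, b i x <= - rho -> B i x), (forall i x, B i x -> b i x <= rho) &
  (forall i j g x, B i x -> B j (act g x) -> forall y, B i y -> B j (act g y))].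
Proof.
have D_ge0 := D0.
have [invB triv _ ex] := inv.
have [B hB] : exists B : 'I_k -> set X,
    forall i, BB (B i) /\ horoball (endpoint (c i)) (B i).
  have /choice[B hB] : forall i : 'I_k, exists A, BB A /\ horoball (endpoint (c i)) A.
    by move=> i; have [A] := ex i; exists A.
  by exists B.
pose P i rho := (forall x, b i x <= - rho -> B i x) /\ (forall x, B i x -> b i x <= rho).
have [i r s rs [P1 P2]|i|rho rho0 hrho] := @ord_uniform_bound R k P.
- by split=> [x h|x /P2 h]; [apply: P1|]; lra.
- have [_ [c' [r [ray' ec BE]]]] := hB i.
  have as1 : asymptotic (c i) c'.
    have : endpoint (c i) c' by rewrite -ec; split=> //; exists 0 => t t0; rewrite mdistxx.
    by case.
  have as2 := asymptotic_sym as1.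
  (* By [beta_asymptotic], the difference of the two Busemann functions stays within [D] of its
     value [e] at [x0]. *)
  pose x0 := c i 0; pose e := b i x0 - beta c' x0.
  exists (`|r| + `|e| + D).
  have n1 := ler_norm r; have n2 := ler_norm e.
  have n3 : - `|r| <= r by rewrite lerNl -normrN ler_norm.
  have n4 : - `|e| <= e by rewrite lerNl -normrN ler_norm.
  have h1 x := beta_asymptotic fp x x0 (ray i) ray' as1.
  have h2 x := beta_asymptotic fp x x0 ray' (ray i) as2.
  split=> x; rewrite BE /= busemannE // lee_fin => hx.
  + have := h2 x; rewrite /e in n1 n2 n3 n4 hx *; lra.
  + have := h1 x; rewrite /e in n1 n2 n3 n4 hx *; lra.
exists rho, B; split => //; try by move=> i x; case: (hrho i) => h1 h2; auto.
move=> i j g x Bx Bgx y By.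
(* Two members of the disjoint system that meet are equal. *)
have <- : act g @` B i = B j.
  apply: triv; [by apply: invB; case: (hB i)|by case: (hB j)|].
  by exists (act g x); split => //; exists x.
by exists y.
Qed.

(** * Position of the orbit with respect to the horoballs *)

Section WithHoroballs.
Variables (rho : R) (B : 'I_k -> set X).
Hypothesis rho0 : 0 <= rho.
Hypothesis Bin : forall i x, b i x <= - rho -> B i x.
Hypothesis Bout : forall i x, B i x -> b i x <= rho.
Hypothesis Bact : forall i j g x, B i x -> B j (act g x) ->
  forall y, B i y -> B j (act g y).

(** [g] maps [B i] into itself, so the translated ray [act g \o c i] ends up in [B i]; its Busemann
    value is bounded there, so it is asymptotic to [c i]. *)
Lemma horoball_stabilizer i g x : B i x -> B i (act g x) -> H i g.
Proof.
have rho_ge0 := rho0.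
move=> Bx Bgx; rewrite HE; apply: asymptotic_isotropy => //.
apply: (@beta_bounded_asymptotic _ _ D fp _ _ rho rho) => //.
  exact: act_ray.
move=> s rs; apply: Bout; apply: Bact Bx Bgx _ _; apply: Bin.
have s0 : 0 <= s := le_trans rho0 rs.
have := beta_ray (ray i) s0; lra.
Qed.

(** Orbit points inside [B i] differ by elements of [H i], which preserve [b i]: they all lie on one
    level. *)
Lemma beta_orbit_ge : exists2 C, 0 <= C & forall i g, - C <= b i (act g o).
Proof.
have rho_ge0 := rho0.
pose P i C := forall g, - C <= b i (act g o).
apply: (@ord_uniform_bound R k P) => [i r s rs Pr g|i].
  by have := Pr g; lra.
have [[g Bg]|nB] := pselect (exists g, B i (act g o)); last first.
  exists rho => g; rewrite leNgt; apply/negP => h; apply: nB; exists g.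
  by apply: Bin; lra.
exists (rho + `|b i (act g o)|) => g'.
have n0 : 0 <= `|b i (act g o)| by [].
have n1 : - `|b i (act g o)| <= b i (act g o) by rewrite lerNl -normrN ler_norm.
rewrite leNgt; apply/negP => h.
have Bg' : B i (act g' o) by apply: Bin; lra.
have Hg : H i (g' * g^-1)%g.
  apply: horoball_stabilizer Bg _; by rewrite -actM // mulgVK.
have := beta_H (act g o) Hg; rewrite -actM // mulgVK => E.
lra.
Qed.

(** Otherwise [a] is near some [act g (c j t)] with [t > T]. Then [g] maps [B j] into [B i], and the
    translated ray descends in [B i] at unit speed, which would push [b i a] below [- E]. *)
Lemma horoball_near_orbit E : 0 <= E -> exists2 C, 0 <= C & forall i a,
  b i a <= - rho -> - E <= b i a -> exists g, d a (act g o) <= C.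
Proof.
have rho_ge0 := rho0; have D_ge0 := D0.
move=> E0; have [C0 C00 hC0] := near_orbit_or_rays.
have [K K0 hK] : exists2 K, 0 <= K & forall i, d (c i 0) o <= K.
  apply: (@ord_uniform_bound R k (fun i K => d (c i 0) o <= K)) => [i r s rs h|i].
    exact: le_trans rs.
  by exists (d (c i 0) o).
pose T := E + 2 * rho + D + 2 * C0.
exists (C0 + T + K) => [|i a ai aE]; first by rewrite /T; lra.
have [[g hg]|[g [j [t [t0 hg]]]]] := hC0 a; first by exists g; rewrite /T; lra.
have [tT|tT] := leP t T.
  exists g; have h1 := metric_triangle a (act g (c j t)) (act g o).
  have h2 := metric_triangle (c j t) (c j 0) o.
  rewrite act_mdist // in h1; have := hK j.
  rewrite ray // subr0 ger0_norm // in h2; lra.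
exfalso.
have hg' : d (act g^-1%g a) (c j t) <= C0 by rewrite act_mdistV // invgK.
have h1 := beta_lip (act g^-1%g a) (c j t) (ray j).
have h2 := beta_ray (ray j) t0.
have Bj : B j (act g^-1%g a) by apply: Bin; rewrite /T in tT; lra.
have Bi : B i (act g (act g^-1%g a)) by rewrite actVK //; apply: Bin.
pose c' s := act g (c j (rho + s)).
have ray' : geodesic_ray c'.
  move=> s s' s0 s0'; rewrite /c' act_mdist // ray; [congr `|_|; lra|lra|lra].
have hc' s : 0 <= s -> b i (c' s) <= rho.
  move=> s0; apply: Bout; apply: Bact Bj Bi _ _; apply: Bin.
  have s1 : 0 <= rho + s by lra.
  have := beta_ray (ray j) s1; lra.
have st : 0 <= t - rho by rewrite /T in tT; lra.
have h3 := beta_ray_descends fp (ray i) ray' hc' st.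
have h4 := hc' 0 (lexx _).
have h5 := beta_lip a (act g (c j t)) (ray i).
have E1 : c' (t - rho) = act g (c j t) by rewrite /c' addrC subrK.
rewrite E1 in h3; rewrite /T in tT; lra.
Qed.

(* Distinct cosets of H i give disjoint horoballs, of which only finitely many
   meet a given ball. *)
Lemma horosphere_near_H E : 0 <= E -> exists2 C, 0 <= C & forall i g,
  b i (act g o) <= E -> exists2 h, H i h & d (act g o) (act h o) <= C.
Proof.
have rho_ge0 := rho0.
move=> E0; pose s := E + rho + 3.
have [net hnet] := proper_net o s proper.
(* Going down by [s] from level [E] reaches [- rho - 2]. If [g] and [g1] share the net point [n],
   then [g1 * g^-1] moves [a] to within 1 of [a1], still inside [B i], so it lies in [H i]. *)
pose Q i n g a := [/\ d (act g o) a = s, b i a <= - rho - 2 & d n (act g^-1%g a) < 1 / 2].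
pose P (p : 'I_k * X) C := forall g a, Q p.1 p.2 g a ->
  exists2 h, H p.1 h & d (act g o) (act h o) <= C.
have [[i n] r t rt Pr g a /Pr [h Hh hh]|[i n] _|C C0 hC] :=
    @seq_uniform_bound R _ [seq (i, n) | i <- enum 'I_k, n <- net] P.
- by exists h => //; exact: le_trans rt.
- have [[g1 [a1 [e1 e2 e3]]]|nQ] := pselect (exists g a, Q i n g a); last first.
    by exists 0 => g a Qga; exfalso; apply: nQ; exists g, a.
  exists (d (act g1 o) o) => g a /= [f1 f2 f3].
  exists (g * g1^-1)%g; last first.
    by rewrite actM // act_mdist // act_mdistV.
  have hd : d (act (g1 * g^-1)%g a) a1 <= 1.
    rewrite actM // act_mdistV //.
    have := metric_triangle (act g^-1%g a) n (act g1^-1%g a1).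
    rewrite (metric_sym _ n); lra.
  have hb := beta_lip (act (g1 * g^-1)%g a) a1 (ray i).
  rewrite (_ : (g * g1^-1)%g = ((g1 * g^-1)^-1)%g); last by rewrite invgM invgK.
  apply: parabolicV; apply: (@horoball_stabilizer i _ a); apply: Bin; lra.
exists C => // i g hg.
have s0 : 0 <= s by rewrite /s; lra.
have [a ga ba] := beta_descend (act g o) geo (ray i) s0.
have [|n ns hn] := hnet (act g^-1%g a).
  by rewrite -act_mdistV // ga.
apply: (hC (i, n) _ g a).
  by apply/allpairsP; exists (i, n); rewrite /= mem_enum.
by split=> //; rewrite /s in ba; lra.
Qed.

End WithHoroballs.

(** Coarse projection of [p] to the horosphere of level 0: as [b i] is 1-Lipschitz, [d p a] is
    minimal up to [2 * E]. *)
Definition entry i (E : R) (p a : X) : Prop :=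
  [/\ - E <= b i a, b i a <= E & d p a <= b i p + E].

Lemma entry_le i E E' p a : E <= E' -> entry i E p a -> entry i E' p a.
Proof. by move=> EE' [*]; split; lra. Qed.

Lemma entry_H i E p a h : H i h -> entry i E p a -> entry i E (act h p) (act h a).
Proof. by move=> Hh [*]; split; rewrite ?beta_H // act_mdist. Qed.

(** Geodesics to a common boundary point converge. The factor 2 arises because replacing [p'] by [p]
    costs [d p p'] both in [d p' a'] and in [b i p']. *)
Lemma entry_lip i E p a p' a' : entry i E p a -> entry i E p' a' ->
  d a a' <= 2 * d p p' + 2 * E + D.
Proof.
move=> [a1 a2 a3] [a1' a2' a3'].
have h0 := mdist_ge0 p p'.
have h1 := metric_triangle p p' a'; have h2 := beta_lip p' p (ray i).
rewrite (metric_sym p' p) in h2.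
have := beta_four_point fp a p a' (ray i); rewrite (metric_sym a p).
by case; lra.
Qed.

(** Going down from [act g o] to a level slightly below [- rho] gives a point near the orbit, and
    orbit points of bounded level are near [H i]. *)
Lemma entry_exists : exists2 E, 0 <= E & forall i g,
  exists2 h, H i h & entry i E (act g o) (act h o).
Proof.
have [rho [B [rho0 Bin Bout Bact]]] := horoball_sets.
have [C1 C10 hC1] := beta_orbit_ge rho0 Bin Bout Bact.
have E0 : 0 <= C1 + rho + 1 by lra.
have [C2 C20 hC2] := horoball_near_orbit rho0 Bin Bout Bact E0.
have [C3 C30 hC3] := horosphere_near_H rho0 Bin Bout Bact C20.
exists (C1 + rho + 1 + C2 + C3) => [|i g]; first lra.
have bg := hC1 i g.
(* The descent ends between levels [- (C1 + rho + 1)] and [- (C1 + rho)]; [C1] makes its length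
   nonnegative. *)
have s0 : 0 <= b i (act g o) + C1 + rho + 1 by lra.
have [a pa ba] := beta_descend (act g o) geo (ray i) s0.
have la := beta_lip (act g o) a (ray i).
have [||g' hg'] := hC2 i a; [lra|lra|].
have lg' := beta_lip (act g' o) a (ray i).
rewrite metric_sym in lg'.
have [|h Hh hh] := hC3 i g'; first lra.
exists h => //.
have bh := hC1 i h.
have lh := beta_lip (act h o) (act g' o) (ray i); rewrite metric_sym in lh.
have t1 := metric_triangle (act g o) a (act h o).
have t2 := metric_triangle a (act g' o) (act h o).
by split; lra.
Qed.

(* For b i m very negative the geodesics from p to m and from p to c i (oo)
   enter the horoball at the same place. *)
Lemma entry_between i E p a m : entry i E p a -> b i m < - (E + D) ->
  d p a + d a m <= d p m + 2 * E + D.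
Proof.
move=> [a1 a2 a3] hm.
have d0 := mdist_ge0 a m.
have := beta_four_point fp a p m (ray i); rewrite (metric_sym a p).
by case; lra.
Qed.

(** The inequalities allow counting [u] from [x] alone or from [y] alone, and [v] from [y^-1 * x]
    alone; the last clause serves to count [y] from [u] and [v]. *)
Lemma triangle_decomposition : exists2 E, 0 <= E & forall x y : G,
  exists (j : option 'I_k) (u v : G),
  [/\ d o (act u o) + d (act u o) (act y o) <= d o (act y o) + E,
      d o (act u o) + d (act u o) (act x o) <= d o (act x o) + E,
      d (act y o) (act (y * v)%g o) + d (act (y * v)%g o) o <= d o (act y o) + E,
      d (act y o) (act (y * v)%g o) + d (act (y * v)%g o) (act x o) <=
        d (act y o) (act x o) + E &
      match j with
      | None => u = (y * v)%g
      | Some i => [/\ H i (u^-1 * y * v)%g, entry i E (act u^-1%g o) o &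
          entry i E (act (u^-1 * y)%g o) (act (u^-1 * y * v)%g o)]
      end].
Proof.
have D_ge0 := D0.
have [E1 E10 hE1] := entry_exists.
have [C0 C00 hC0] := near_orbit_or_rays.
have [K K0 hK] : exists2 K, 0 <= K & forall i, d (c i 0) o <= K.
  apply: (@ord_uniform_bound R k (fun i K => d (c i 0) o <= K)) => [i r s rs h|i].
    exact: le_trans rs.
  by exists (d (c i 0) o).
(* Beyond [T], a point within [C0] of the ray is deep enough for [entry_between]. *)
pose T := C0 + E1 + D + 1.
pose C1 := C0 + T + K.
have C1_ge0 : 0 <= C1 by rewrite /C1 /T; lra.
exists (2 * C1 + 2 * E1 + 2 * D) => [|x y]; first by rewrite /C1 /T; lra.
have [m [m1 m2 m3]] := triangle_center o (act y o) (act x o) geo fp D0.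
have [[g hg]|[i [g [t [t0 [tT hg]]]]]] :
    (exists g, d m (act g o) <= C1) \/
    exists i g t, 0 <= t /\ T < t /\ d m (act g (c i t)) <= C0.
- have [[g hg]|[g [i [t [t0 hg]]]]] := hC0 m.
    by left; exists g; rewrite /C1 /T; lra.
  have [tT|tT] := leP t T; last by right; exists i, g, t.
  left; exists g; have h1 := metric_triangle m (act g (c i t)) (act g o).
  have h2 := metric_triangle (c i t) (c i 0) o.
  rewrite act_mdist // in h1; have := hK i.
  rewrite ray // subr0 ger0_norm // in h2; rewrite /C1; lra.
(* Center near the orbit: [u] and [y * v] are both that orbit element. *)
- exists None, g, (y^-1 * g)%g; rewrite mulVKg.
  have t1 := metric_triangle o m (act g o).
  have t2 := metric_triangle (act g o) m (act y o).
  have t3 := metric_triangle (act g o) m (act x o).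
  have t4 := metric_triangle (act y o) m (act g o).
  have t5 := metric_triangle (act g o) m o.
  have s1 := metric_sym (act g o) m; have s2 := metric_sym (act y o) m.
  have s3 := metric_sym m o.
  by split=> //; lra.
(* Center deep in a horoball: after translation by [g^-1], [h1] and [h2] are the entries of the
   geodesics from [o] and [act y o] to [m]. *)
- have [h1 Hh1 e1] := hE1 i g^-1%g.
  have [h2 Hh2 e2] := hE1 i (g^-1 * y)%g.
  have dm : d (act g^-1%g m) (c i t) <= C0 by rewrite act_mdistV // invgK.
  have bm : b i (act g^-1%g m) < - (E1 + D).
    have := beta_lip (act g^-1%g m) (c i t) (ray i); have := beta_ray (ray i) t0.
    rewrite /T in tT; lra.
  have translate p a : d (act g^-1%g p) a + d a (act g^-1%g m) <=
      d (act g^-1%g p) (act g^-1%g m) + 2 * E1 + D ->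
      d p (act g a) + d (act g a) m <= d p m + 2 * E1 + D.
    rewrite (act_mdist isom) (act_mdistV isom g^-1%g p) (metric_sym a).
    by rewrite (act_mdistV isom g^-1%g m) invgK (metric_sym m).
  have := translate _ _ (entry_between e1 bm); rewrite -(actM isom) => b1.
  rewrite (actM isom g^-1%g y) in e2.
  have := translate _ _ (entry_between e2 bm); rewrite -(actM isom) => b2.
  exists (Some i), (g * h1)%g, (y^-1 * (g * h2))%g; rewrite mulVKg.
  have uyv : ((g * h1)^-1 * y * (y^-1 * (g * h2)) = h1^-1 * h2)%g.
    by rewrite -mulgA mulVKg invgM -mulgA mulKg.
  have t1 := metric_triangle (act (g * h1)%g o) m (act y o).
  have t2 := metric_triangle (act (g * h1)%g o) m (act x o).
  have t3 := metric_triangle (act (g * h2)%g o) m o.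
  have t4 := metric_triangle (act (g * h2)%g o) m (act x o).
  have s1 := metric_sym (act (g * h1)%g o) m.
  have s2 := metric_sym (act (g * h2)%g o) m.
  have s3 := metric_sym m o; have s4 := metric_sym (act y o) m.
  have s5 := metric_sym (act y o) o.
  split; [lra|lra|lra|lra|split].
  + rewrite uyv; apply: parabolicM => //; exact: parabolicV.
  + apply: (@entry_le _ E1); first lra.
    have := entry_H (parabolicV Hh1) e1; rewrite -!actM // mulVg act1 //.
    by rewrite invgM.
  + apply: (@entry_le _ E1); first lra.
    by rewrite uyv invgM !(actM isom); exact: entry_H (parabolicV Hh1) e2.
Qed.

(* Up to bounded error, the entry points along a word in G form a path in H i
   with bounded steps: H i is undistorted. *)
Lemma parabolic_word_bound (S : set G) (Si : 'I_k -> set G) (C E : R) :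
  0 <= C -> (forall s, S s \/ S s^-1%g -> d o (act s o) <= C) ->
  (forall i, generated (Si i) = H i) -> 0 <= E ->
  exists2 L : R, 0 <= L & forall i w g p h h', word_for S g w ->
    H i h -> H i h' -> entry i E (act p o) (act h o) ->
    entry i E (act (p * g)%g o) (act h' o) ->
    exists2 w', word_for (Si i) (h^-1 * h')%g w' &
      (size w')%:R <= L * (size w).+1%:R.
Proof.
have D_ge0 := D0.
move=> C0 SC SiH E0; have [E1 E10 hE1] := entry_exists.
(* [K] is the bound of [entry_lip] for points at distance [C]; finitely many elements of [H i] move
   [o] by at most [K]. *)
pose K := 2 * C + 2 * (E + E1) + D.
pose F i := [set h | H i h /\ d o (act h o) <= K].
have [L L0 hL] : exists2 L : R, 0 <= L & forall i h, F i h ->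
    exists2 w, word_for (Si i) h w & (size w)%:R <= L.
  pose P i (L : R) := forall h, F i h -> exists2 w, word_for (Si i) h w & (size w)%:R <= L.
  apply: (@ord_uniform_bound R k P) => [i a a' aa' Pa h /Pa[w wh wa]|i].
    by exists w => //; exact: le_trans aa'.
  have [||L _ hL] := @finite_word_bound R G (Si i) (F i).
  - by apply: sub_finite_set (proper_finite o K proper pd) => h [].
  - by rewrite SiH => h [].
  - by exists L.
have step i p p' h h' : H i h -> H i h' -> d (act p o) (act p' o) <= C ->
    entry i (E + E1) (act p o) (act h o) -> entry i (E + E1) (act p' o) (act h' o) ->
    F i (h^-1 * h')%g.
  move=> Hh Hh' pp' e e'; split; first by apply: parabolicM => //; exact: parabolicV.
  rewrite actM // -(act_mdist isom h) actVK //.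
  have := entry_lip e e'; rewrite /K; lra.
exists L => // i w g p h h' wg Hh Hh' e e'.
have {} e : entry i (E + E1) (act p o) (act h o) by apply: entry_le e; lra.
have {} e' : entry i (E + E1) (act (p * g)%g o) (act h' o) by apply: entry_le e'; lra.
(* The empty word still costs one step from [h] to [h'], whence the successor in the bound. *)
elim: w g p h wg Hh e e' => [|s w IH] g p h wg Hh e e'.
  have [w' ww' sw'] : exists2 w, word_for (Si i) (h^-1 * h')%g w & (size w)%:R <= L.
    apply: hL; apply: step e e' => //.
    by case: wg => _ <-; rewrite big_nil mulg1 mdistxx.
  by exists w' => //; rewrite mulr1.
have [Ss [g' gE wg']] := word_for_cons wg.
have [h1 Hh1 e1] := hE1 i (p * s)%g.
have {} e1 : entry i (E + E1) (act (p * s)%g o) (act h1 o) by apply: entry_le e1; lra.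
have [w1 ww1 sw1] : exists2 w, word_for (Si i) (h^-1 * h1)%g w & (size w)%:R <= L.
  by apply: hL; apply: step e e1 => //; rewrite actM // act_mdist // SC.
have [|w2 ww2 sw2] := IH g' (p * s)%g h1 wg' Hh1 e1.
  by rewrite -mulgA -gE.
exists (w1 ++ w2).
  by have := word_for_cat ww1 ww2; rewrite -mulgA mulVKg.
by rewrite size_cat natrD mulrS mulrDr mulr1 lerD.
Qed.

(* Along a geodesic the distance to o determines a point up to bounded error. *)
Lemma near_geodesic_count (E : R) : exists N : nat, forall (q : X) (r : R),
  exists2 s : seq G, (size s <= (Num.truncn r).+1 * N)%N &
    forall u, d o (act u o) <= r ->
      d o (act u o) + d (act u o) q <= d o q + E -> u \in s.
Proof.
have [T hT] := (iffLR (finite_seqP _) (proper_finite o (E + 1 + D) proper pd)).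
have inT g : d o (act g o) <= E + 1 + D -> g \in T.
  by move=> hg; have : [set` T] g by rewrite -hT.
exists (size T) => q r.
(* Slices by the integer part of the distance to [o]: by the four-point inequality, two elements of
   a slice differ by an element of [T]. *)
pose good n u := [/\ Num.truncn (d o (act u o)) = n,
  d o (act u o) <= r & d o (act u o) + d (act u o) q <= d o q + E].
have /choice[s hs] : forall n, exists s : seq G, (size s <= size T)%N /\
    forall u, good n u -> u \in s.
  move=> n; have [[u0 [n0 _ h0]]|nog] := pselect (exists u, good n u); last first.
    by exists [::]; split => // u gu; case: nog; exists u.
  exists [seq (u0 * t)%g | t <- T]; split=> [|u [nu _ hu]]; first by rewrite size_map.
  rewrite -(mulVKg u0 u); apply: map_f; apply: inT.
  rewrite actM // -(act_mdist isom u0) actVK //.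
  have := truncn_itv (mdist_ge0 o (act u o)); rewrite nu -addn1 natrD => /andP[a1 a2].
  have := truncn_itv (mdist_ge0 o (act u0 o)); rewrite n0 -addn1 natrD => /andP[b1 b2].
  have s1 := metric_sym o (act u0 o); have s2 := metric_sym o (act u o).
  by have [h|h] := four_pointP fp (act u0 o) o (act u o) q; lra.
exists (flatten [seq s n | n <- iota 0 (Num.truncn r).+1]).
  apply: leq_trans (_ : size (iota 0 (Num.truncn r).+1) * size T <= _)%N.
    by apply: size_flatten_le => n _; case: (hs n).
  by rewrite size_iota.
move=> u h1 h2; apply/flattenP; exists (s (Num.truncn (d o (act u o)))).
  by apply: map_f; rewrite mem_iota /= ltnS le_truncn.
by case: (hs (Num.truncn (d o (act u o)))) => _; apply.
Qed.

End Parabolic.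

(** * Norms on finite sets and a criterion for property RD *)

Section L2.
Variables (R : realType) (G : groupType).
Implicit Types (f g : G -> R[i]).
Local Notation normc := ComplexField.Normc.normc.

Let EFin_sqr_sqrt (B : R) : 0 <= B -> B%:E = sqrte ((B ^+ 2)%:E).
Proof. by move=> B0; rewrite /sqrte /= sqrtr_sqr ger0_norm. Qed.

Lemma l2norm_sum_le f (s : seq G) (B : R) : uniq s -> 0 <= B ->
  (l2norm f <= B%:E)%E -> \sum_(x <- s) normc (f x) ^+ 2 <= B ^+ 2.
Proof.
move=> us B0; rewrite (EFin_sqr_sqrt B0) /l2norm lee_sqrt ?lee_fin ?sqr_ge0 // => fB.
rewrite -lee_fin; apply: le_trans fB; apply: esum_ge; exists [set` s].
  by split => //; exact: finite_seq.
by rewrite -fsbig_seq // sumEFin.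
Qed.

Lemma l2norm_le f (B : R) : 0 <= B ->
  (forall s : seq G, uniq s -> \sum_(x <- s) normc (f x) ^+ 2 <= B ^+ 2) ->
  (l2norm f <= B%:E)%E.
Proof.
move=> B0 fB; rewrite (EFin_sqr_sqrt B0) /l2norm lee_sqrt ?lee_fin ?sqr_ge0 //.
apply: ge_ereal_sup => _ [A [finA _] <-].
rewrite fsbig_finite // sumEFin lee_fin; apply: fB; exact: finmap.fset_uniq.
Qed.

Lemma normc_sum_le (I : Type) (s : seq I) (F : I -> R[i]) :
  normc (\sum_(i <- s) F i) <= \sum_(i <- s) normc (F i).
Proof.
elim/big_ind2: _ => [|z1 r1 z2 r2 h1 h2|//].
  by rewrite ComplexField.Normc.normc0.
by apply: le_trans (le_normcD _ _) _; exact: lerD.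
Qed.

Lemma normc_ge0 (z : R[i]) : 0 <= normc z.
Proof. by case: z => a b; exact: sqrtr_ge0. Qed.

Lemma property_RD_criterion (L : eqType) (l : G -> R) (P : {poly R}) :
  (forall r, 0 <= r -> exists (M : nat) (U V : G -> G -> L),
    [/\ M%:R <= P.[r],
      (forall x, exists2 s : seq L, (size s <= M)%N &
         forall y, l y <= r -> U x y \in s),
      (forall y, l y <= r -> exists2 s : seq L, (size s <= M)%N &
         forall x, U x y \in s),
      (forall z, exists2 s : seq L, (size s <= M)%N &
         forall x y, l y <= r -> (y^-1 * x)%g = z -> V x y \in s) &
      (forall u v, exists2 s : seq G, (size s <= M)%N &
         forall x y, l y <= r -> U x y = u -> V x y = v -> y \in s)]) ->
  property_RD l.
Proof.
(* [convolution_bound] gives the factor [M ^ 2]; the added 1 keeps the polynomial positive, for the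
   case of an infinite [l2norm f]. *)
move=> hP; exists (P ^+ 2 + 1) => r f r0 ffin fr.
have [M [U [V [MP h1 h2 h3 h4]]]] := hP r r0.
have M0 : 0 <= M%:R :> R by [].
have P0 : M%:R ^+ 2 <= (P ^+ 2 + 1).[r].
  by rewrite hornerD horner_exp hornerC -[X in X <= _]addr0 lerD // ler_pM.
have P1 : 0 < (P ^+ 2 + 1).[r].
  by rewrite hornerD horner_exp hornerC ltr_wpDl // sqr_ge0.
apply: ge_ereal_sup => _ [g /= g1 <-].
have f0 : (0 <= l2norm f)%E by exact: sqrte_ge0.
case Ef : (l2norm f) f0 => [a| |] // a0; last by rewrite gt0_muley // leey.
rewrite lee_fin in a0; rewrite -EFinM.
apply: (@le_trans _ _ ((M%:R ^+ 2 * a)%:E)); last first.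
  by rewrite lee_fin ler_wpM2r.
apply: l2norm_le => [|X uX]; first by rewrite mulr_ge0 ?exprn_ge0.
pose Y : seq G := finmap.enum_fset (fset_set [set x | f x != 0]).
have uY : uniq Y by exact: finmap.fset_uniq.
have inY y : (y \in Y) = (f y != 0) by rewrite /Y in_fset_set //; apply/idP/idP; rewrite inE.
have Yl y : y \in Y -> l y <= r by rewrite inY; exact: fr.
pose Z := undup [seq (y^-1 * x)%g | x <- X, y <- Y].
have convE x : normc (convolution f g x) <=
    \sum_(y <- Y) normc (f y) * normc (g (y^-1 * x)%g).
  rewrite /convolution (@fsbigE _ _ _ _ _ Y) //; last first.
    by move=> y _; rewrite inY negbK => /eqP ->; rewrite mul0r.
  under eq_bigl do rewrite in_setT.
  apply: le_trans (normc_sum_le _ _) _.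
  by under eq_bigr do rewrite ComplexField.Normc.normcM.
apply: (@le_trans _ _ (\sum_(x <- X)
    (\sum_(y <- Y) normc (f y) * normc (g (y^-1 * x)%g)) ^+ 2)).
  by apply: ler_sum => x _; rewrite lerXn2r ?nnegrE ?normc_ge0 ?(le_trans (normc_ge0 _) (convE x)).
apply: le_trans (@convolution_bound R G L X Y Z U V M
  (fun y => normc (f y)) (fun z => normc (g z)) uX uY (undup_uniq _) _ _ _ _ _) _.
- by move=> x y xX yY; rewrite mem_undup; apply/allpairsP; exists (x, y).
- by move=> x _; have [s sM hs] := h1 x; exists s => // y /Yl; exact: hs.
- by move=> y /Yl yl; have [s sM hs] := h2 y yl; exists s => // x _; exact: hs.
- by move=> z; have [s sM hs] := h3 z; exists s => // x y _ /Yl; exact: hs.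
- by move=> u v; have [s sM hs] := h4 u v; exists s => // x y _ /Yl; exact: hs.
have fY : \sum_(y <- Y) normc (f y) ^+ 2 <= a ^+ 2.
  by apply: l2norm_sum_le => //; rewrite Ef.
have gZ : \sum_(z <- Z) normc (g z) ^+ 2 <= 1 ^+ 2.
  by apply: l2norm_sum_le; rewrite ?undup_uniq // g1.
have -> : (M%:R ^+ 2 * a) ^+ 2 = M%:R ^+ 4 * a ^+ 2 * 1 ^+ 2 by ring.
have S0 (s : seq G) h : 0 <= \sum_(x <- s) normc (h x) ^+ 2.
  by apply: sumr_ge0 => x _; exact: sqr_ge0.
apply: ler_pM; [|exact: S0| |exact: gZ].
  by rewrite mulr_ge0 ?exprn_ge0 ?S0.
by rewrite ler_wpM2l ?exprn_ge0.
Qed.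

End L2.

(** * Counting the labels in [G] *)

Theorem theorem0p1 (R : realType) (G : groupType) (S : set G) (k : nat)
    (H : 'I_k -> set G)
    (S_finite : finite_set S)
    (S_generates : generated S = [set: G]%classic)
    (H_hyp : relatively_hyperbolic R H)
    (H_growth : forall i, polynomial_growth R (H i)) :
  property_RD (@word_length R G S).
Proof.
have [_ [X [proper geo [delta slim] [act [isom pd [c [ray lifts HE HB]]]]]]] := H_hyp.
move=> [BB inv _].
have [D D0 fp] := slim_four_point geo slim.
have [x0 _] : exists x0 : X, True.
  have [q [[qs _ _] _]] := lifts.
  by have [x0 _ _] := qs 0 (or_introl erefl); exists x0.
pose d := @mdist R X.
have [E E0 decomp] := triangle_decomposition x0 isom proper geo D0 fp ray lifts HE HB inv.
have /choice[Si hSi] := H_growth.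
have SiH i : generated (Si i) = H i by case: (hSi i).
have /choice[Pi hPi] : forall i, exists P : {poly R}, forall r : R, 0 <= r ->
    exists2 n : nat,
      ([set h | H i h /\ word_length R (Si i) h <= r] #<= `I_n)%card & n%:R <= P.[r].
  by move=> i; case: (hSi i).
have [C C0 hC] : exists2 C : R, 0 <= C &
    forall s, S s \/ S s^-1%g -> d x0 (act s x0) <= C.
  have [t St] := (iffLR (finite_seqP _) S_finite).
  have [s a b ab ha|s _|C C0 hC] := @seq_uniform_bound R G t
      (fun s a => d x0 (act s x0) <= a).
  - exact: le_trans ab.
  - by exists (d x0 (act s x0)).
  exists C => // s; rewrite St => -[/= st|/= st]; first exact: hC.
  by have := hC _ st; rewrite /d -(act_mdistV isom) metric_sym.
have [L L0 hL] := parabolic_word_bound isom pd proper geo D0 fp ray lifts HE HB inv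
  C0 hC SiH E0.
have [N hN] := near_geodesic_count x0 isom pd proper fp E.
(* The terms of [Q] bound those of [M] below: elements near a geodesic for each of the [k + 1]
   values of [j], short elements of the [H i], and the single [y] of the case [None]. *)
pose Q : {poly R} := (k.+1 * N)%:R%:P * (C%:P * ('X + 1) + E%:P + 1) +
  \sum_(i < k) (Pi i \Po (L%:P * ('X + 2%:P))) + 1.
have /choice[lab hlab] : forall xy : G * G, exists t : (option 'I_k * G) * G,
  let x := xy.1 in let y := xy.2 in let u := t.1.2 in let v := t.2 in
  [/\ d x0 (act u x0) + d (act u x0) (act y x0) <= d x0 (act y x0) + E,
      d x0 (act u x0) + d (act u x0) (act x x0) <= d x0 (act x x0) + E,
      d (act y x0) (act (y * v)%g x0) + d (act (y * v)%g x0) x0 <= d x0 (act y x0) + E,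
      d (act y x0) (act (y * v)%g x0) + d (act (y * v)%g x0) (act x x0) <=
        d (act y x0) (act x x0) + E &
      match t.1.1 with
      | None => u = (y * v)%g
      | Some i => [/\ H i (u^-1 * y * v)%g, entry c i E (act u^-1%g x0) x0 &
          entry c i E (act (u^-1 * y)%g x0) (act (u^-1 * y * v)%g x0)]
      end].
  by move=> [x y]; have [j [u [v h]]] := decomp x y; exists (j, u, v).
apply: (@property_RD_criterion R G (option 'I_k * G)%type _ Q) => r r0.
(* A word for [y] has length at most [r + 1], and [parabolic_word_bound] adds one more. *)
have r2 : 0 <= L * (r + 2) by apply: mulr_ge0 => //; lra.
have /choice[n hn] : forall i, exists n : nat,
    ([set h | H i h /\ word_length R (Si i) h <= L * (r + 2)] #<= `I_n)%card /\
    n%:R <= (Pi i).[L * (r + 2)].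
  by move=> i; have [n n1 n2] := hPi i _ r2; exists n.
pose rho := C * (r + 1) + E.
have rho0 : 0 <= rho by apply: addr_ge0 => //; apply: mulr_ge0 => //; lra.
pose M := (k.+1 * ((Num.truncn rho).+1 * N) + \sum_(i < k) n i + 1)%N.
have MnE : (k.+1 * ((Num.truncn rho).+1 * N) <= M)%N by rewrite /M -addnA leq_addr.
pose labels (s : seq G) : seq (option 'I_k * G) :=
  [seq (j, u) | j <- enum {: option 'I_k}, u <- s].
have label_count (s : seq G) : (size s <= (Num.truncn rho).+1 * N)%N ->
    (size (labels s) <= M)%N.
  move=> sN; apply: leq_trans MnE.
  by rewrite size_allpairs -cardE card_option card_ord leq_mul2l sN orbT.
have in_labels (s : seq G) j u : u \in s -> (j, u) \in labels s.
  by move=> us; apply/allpairsP; exists (j, u); rewrite mem_enum.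
have word y : word_length R S y <= r ->
    exists2 w, word_for S y w & (size w)%:R <= r + 1.
  by apply: word_length_word; rewrite S_generates.
have word_dist w : forall y, word_for S y w -> d x0 (act y x0) <= C * (size w)%:R.
  elim: w => [|s w IH] y wy.
    by case: wy => _ <-; rewrite big_nil act1 // /d mdistxx mulr0.
  have [Ss [y' -> wy']] := word_for_cons wy.
  rewrite actM //; apply: le_trans (metric_triangle _ (act s x0) _) _.
  by rewrite (act_mdist isom) /= mulrS mulrDr mulr1; apply: lerD; [exact: hC|exact: IH].
have dist y : word_length R S y <= r -> d x0 (act y x0) <= C * (r + 1).
  move=> /word[w wy sw]; apply: le_trans (word_dist w y wy) _.
  exact: ler_wpM2l.
exists M, (fun x y => (lab (x, y)).1), (fun x y => ((lab (x, y)).1.1, (lab (x, y)).2)).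
split.
- have truncS : (Num.truncn rho).+1%:R <= rho + 1.
    by rewrite -addn1 natrD lerD2r truncn_le.
  have ME : M = (k.+1 * N * (Num.truncn rho).+1 + \sum_(i < k) n i + 1)%N.
    by rewrite /M -mulnA (mulnC N).
  rewrite ME natrD natrD (natrM _ (k.+1 * N)) natr_sum /Q !hornerE /= lerD2r; apply: lerD.
    exact: ler_wpM2l.
  rewrite horner_sum; apply: ler_sum => i _; rewrite horner_comp hornerM hornerD hornerX !hornerC.
  by case: (hn i).
- move=> x; have [s sN hs] := hN (act x x0) rho; exists (labels s); first exact: label_count.
  move=> y /dist dy; have [h1 h2 _ _ _] := hlab (x, y).
  case: (lab (x, y)) h1 h2 => -[j u] v /= h1 h2; apply: in_labels; apply: hs => //.
  have := mdist_ge0 (act u x0) (act y x0); rewrite /rho /d in h1 dy *; lra.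
- move=> y /dist dy; have [s sN hs] := hN (act y x0) rho; exists (labels s); first exact: label_count.
  move=> x; have [h1 _ _ _ _] := hlab (x, y).
  case: (lab (x, y)) h1 => -[j u] v /= h1; apply: in_labels; apply: hs => //.
  have := mdist_ge0 (act u x0) (act y x0); rewrite /rho /d in h1 dy *; lra.
- move=> z; have [s sN hs] := hN (act z x0) rho; exists (labels s); first exact: label_count.
  move=> x y /dist dy yx; have [_ _ h3 h4 _] := hlab (x, y).
  case: (lab (x, y)) h3 h4 => -[j u] v /=.
  have -> : act x x0 = act y (act z x0) by rewrite -yx -actM // mulVKg.
  rewrite actM // /d !(act_mdist isom) => h3 h4; apply: in_labels; apply: hs => //.
  have := mdist_ge0 (act y (act v x0)) x0; rewrite /rho /d in h3 dy *; lra.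
- move=> [[i|] u] [j v]; last first.
    exists [:: (u * v^-1)%g] => [|x y _]; first by rewrite /M addn1.
    have [_ _ _ _] := hlab (x, y); case: (lab (x, y)) => -[j' u'] v' /=.
    (* Without a horoball, [u = y * v] determines [y]. *)
    by move=> h [jE uE] [_ vE]; move: h; rewrite jE uE vE => ->; rewrite mulgK mem_seq1.
  have [ni _] := hn i; have fin := card_le_finite ni (finite_II _).
  pose s := finmap.enum_fset (fset_set [set h | H i h /\ word_length R (Si i) h <= L * (r + 2)]).
  exists [seq (u * h * v^-1)%g | h <- s].
    rewrite size_map; apply: leq_trans (geq_card_fset_set ni) _.
    rewrite /M (bigD1 i) //= addn1; apply: leqW.
    by rewrite addnA addnAC leq_addl.
  move=> x y yr; have [_ _ _ _] := hlab (x, y); case: (lab (x, y)) => -[j' u'] v' /=.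
  move=> h [jE uE] [_ vE]; move: h; rewrite jE uE vE => -[Hh e1 e2].
  apply/mapP; exists (u^-1 * y * v)%g; last by rewrite -!mulgA mulgV mulg1 mulVKg.
  rewrite /s in_fset_set // inE /=; split => //.
  have [w wy sw] := word y yr.
  (* The word for [y], read from [u^-1], leads from a point with entry 1 to one with entry
     [u^-1 * y * v]. *)
  have {}e1 : entry c i E (act u^-1%g x0) (act 1%g x0) by rewrite act1.
  have [w' ww' sw'] := hL i w y _ _ _ wy (parabolic1 isom HE i) Hh e1 e2.
  rewrite invg1 mul1g in ww'.
  apply: le_trans (word_length_le R ww') _; apply: le_trans sw' _.
  rewrite ler_wpM2l // -addn1 natrD; lra.
Qed.
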